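(* There exists a consistent atomic RCC8 network over $\{\mathbf{EC},\mathbf{DC},\mathbf{TPP},\mathbf{TPP}^{-1}\}$ which has no convex solution in $\mathbb{R}^3$.
   Context: A region in $\mathbb{R}^n$ ($n\geq 1$) is a nonempty regular closed subset $X$, i.e. $X=\mathrm{cl}(\mathrm{int}(X))$; write $i(X)$ for the interior. The eight RCC8 base relations between regions $a,b$ (jointly exhaustive and pairwise disjoint; $\subset$ denotes proper inclusion) are: $a\,\mathbf{EQ}\,b$: $a=b$; $a\,\mathbf{DC}\,b$: $a\cap b=\emptyset$; $a\,\mathbf{EC}\,b$: $a\cap b\neq\emptyset$ and $i(a)\cap i(b)=\emptyset$; $a\,\mathbf{PO}\,b$: $i(a)\cap i(b)\neq\emptyset$, $a\not\subseteq b$, $b\not\subseteq a$; $a\,\mathbf{TPP}\,b$: $a\subset b$ and $a\not\subset i(b)$; $a\,\mathbf{NTPP}\,b$: $a\subset i(b)$; and the converses $\mathbf{TPP}^{-1}$, $\mathbf{NTPP}^{-1}$ of the last two. Let $V$ be a finite set of variables. An RCC8 constraint is an expression $u\,R\,v$ with $u,v\in V$ and $R$ a nonempty set of base relations; an RCC8 network is a set of such constraints. It is atomic if for every pair of distinct variables $u,v$ it contains a constraint $u\,R\,v$ or $v\,R\,u$ with $R$ a singleton. It is a network over a set $\mathcal{R}$ of base relations if every constraint $u\,R\,v$ in it has $R\subseteq\mathcal{R}$. An $n$-dimensional solution (solution in $\mathbb{R}^n$) of a network is a map $\mathcal{S}$ from $V$ to regions of $\mathbb{R}^n$ such that for each constraint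 $u\,R\,v$ the base relation holding between $\mathcal{S}(u)$ and $\mathcal{S}(v)$ belongs to $R$. A network is consistent if it has a solution in $\mathbb{R}^n$ for some $n\geq 1$ (the regions need not be convex or connected). A solution is convex if every $\mathcal{S}(v)$ is a convex set. *)

(* Defs.v *)
From mathcomp Require Import all_boot all_order all_algebra.
From mathcomp Require Import all_classical all_reals all_analysis.

Set Implicit Arguments.
Unset Strict Implicit.
Unset Printing Implicit Defensive.

Import numFieldNormedType.Exports.

Local Open Scope classical_set_scope.

(* ['rV[R]_n] carries the product (= Euclidean) topology. *)
Record region (R : realType) (n : nat) := Region {
  region_set :> set 'rV[R]_n;
  region_nonempty : region_set !=set0;
  region_regular : region_set = closure (interior region_set) }.

Inductive rcc8 := EQ | DC | EC | PO | TPP | NTPP | TPPi | NTPPi.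

(* [`<`] is proper inclusion.  Its use in TPP and NTPP, rather than [`<=`],
   matters only when a = b is the whole space, where EQ alone must hold. *)
Definition rcc8_holds (R : realType) (n : nat) (r : rcc8) (a b : region R n)
    : Prop :=
  let tpp (x y : set 'rV[R]_n) := x `<` y /\ ~ (x `<` interior y) in
  let ntpp (x y : set 'rV[R]_n) := x `<` interior y in
  match r with
  | EQ => (a : set _) = b
  | DC => a `&` b = set0
  | EC => a `&` b !=set0 /\ interior a `&` interior b = set0
  | PO => [/\ interior a `&` interior b !=set0, ~ (a `<=` b) & ~ (b `<=` a)]
  | TPP => tpp a b
  | NTPP => ntpp a b
  | TPPi => tpp b a
  | NTPPi => ntpp b a
  end.

Record rcc8_constraint (V : finType) := Constraint {
  cfst : V;
  crel : set rcc8;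
  csnd : V;
  crel_nonempty : crel !=set0 }.

Definition rcc8_network (V : finType) := set (rcc8_constraint V).

Definition atomic (V : finType) (N : rcc8_network V) : Prop :=
  forall u v : V, u <> v ->
    exists2 c, N c &
      ((cfst c = u /\ csnd c = v) \/ (cfst c = v /\ csnd c = u)) /\
      exists r, crel c = [set r].

Definition network_over (V : finType) (A : set rcc8) (N : rcc8_network V)
    : Prop :=
  forall c, N c -> crel c `<=` A.

Definition solution (R : realType) (n : nat) (V : finType)
    (N : rcc8_network V) (S : V -> region R n) : Prop :=
  forall c, N c ->
    exists2 r, crel c r & rcc8_holds r (S (cfst c)) (S (csnd c)).

Definition consistent (R : realType) (V : finType) (N : rcc8_network V)
    : Prop :=
  exists n : nat, (1 <= n)%N /\ exists S : V -> region R n, solution N S.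

Definition convex_solution (R : realType) (n : nat) (V : finType)
    (N : rcc8_network V) (S : V -> region R n) : Prop :=
  solution N S /\ forall v, convex_set (S v : set 'rV[R]_n).

(* Main.v *)
Require Import Defs.
From mathcomp Require Import all_boot all_order all_algebra.
From mathcomp Require Import all_classical all_reals all_analysis.
From mathcomp Require Import ring lra zify.

(* The network describes two externally connected bodies b and c, five disjoint
   "vertex" parts a_i of b touching c and disjoint "edge" parts of c touching b,
   where the vertex parts and edge parts in contact are those incident in the
   complete graph K5.  In a convex solution the convex set b `&` c has empty
   interior, so in R^3 all the contact points lie in one plane, where they
   yield a drawing of K5 in which disjoint edges do not meet: each edge is
   drawn as a polygonal path inside a vertex part, an edge part, and a vertex
   part.  Such a drawing is impossible by van Kampen's parity argument.
   Perturb the points into general position; replacing the drawing of one edge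
   by another changes the number of crossings with the triangle on the three
   other vertices by an even number, since two closed curves cross evenly, so
   the number of crossings of disjoint edges has the parity of that of the
   straight-line drawing, and five points always have an odd number of
   crossings.
   Without convexity the contacts can be placed independently of each other,
   and finite unions of intervals already solve the network in R^1. *)

Set Implicit Arguments.
Unset Strict Implicit.
Unset Printing Implicit Defensive.

Import Order.TTheory GRing.Theory Num.Theory.
Import numFieldNormedType.Exports.

(** * Crossing parity *)

Section Chirotope.
Variables (T : eqType) (o : T -> T -> T -> bool).

(* The last two clauses are the sign conditions imposed by the identities
   [abc][ade] - [abd][ace] + [abe][acd] = 0 and
   [bcd] - [acd] + [abd] - [abc] = 0 between orientation determinants. *)
Definition chirotope : Prop :=
  [/\ forall a b c, o b c a = o a b c,
      forall a b c, uniq [:: a; b; c] -> o b a c = ~~ o a b c,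
      forall a b c d e, uniq [:: a; b; c; d; e] ->
        ~~ [&& o a b c == o a d e, o a b d != o a c e & o a b e == o a c d]
         && ~~ [&& o a b c != o a d e, o a b d == o a c e & o a b e != o a c d]
    & forall a b c d, uniq [:: a; b; c; d] ->
        ~~ [&& o b c d, ~~ o a c d, o a b d & ~~ o a b c]
         && ~~ [&& ~~ o b c d, o a c d, ~~ o a b d & o a b c]].

Definition crosses p q r s : bool :=
  (o p r s (+) o q r s) && (o p q r (+) o p q s).

Definition inside p a b c : bool :=
  (o p a b == o p b c) && (o p b c == o p c a).

Hypothesis oP : chirotope.

Let o_swap a b c : uniq [:: a; b; c] ->
  [/\ o b a c = ~~ o a b c, o a c b = ~~ o a b c, o c b a = ~~ o a b c,
      o b c a = o a b c & o c a b = o a b c].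
Proof.
case: oP => oC oN _ _ u; have ouN := oN _ _ _ u.
by split; rewrite -?ouN // ?(oC c b a) -?(oC a c b) -?(oC c b a) ?oC //
  -?(oC b a c).
Qed.

Ltac sort_brackets u :=
  let e := fresh "e" in
  case: (o_swap u); do 5!(move=> e; rewrite ?e {e}).

(* A segment crosses the boundary of a triangle an odd number of times iff
   exactly one of its ends is inside, and any five points in general position
   span an odd number of crossing pairs of segments. *)
Lemma crosses_parity5 a b c d e (s := [:: a; b; c; d; e]) : uniq s ->
  crosses a b c d (+) crosses a b d e (+) crosses a b e c =
    inside a c d e (+) inside b c d e /\
  crosses a b c d (+) crosses a c b d (+) crosses a d b c
  (+) crosses a b c e (+) crosses a c b e (+) crosses a e b c
  (+) crosses a b d e (+) crosses a d b e (+) crosses a e b d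
  (+) crosses a c d e (+) crosses a d c e (+) crosses a e c d
  (+) crosses b c d e (+) crosses b d c e (+) crosses b e c d.
Proof.
move=> us; have um m : uniq (mask m s) := mask_uniq us m.
have ur n : uniq (rot n s) by rewrite rot_uniq.
case: (oP) => _ _ gp aff.
(* Each of the five points serves once as base point [a] of the three-term condition, and each is
   omitted once from the four-term one. *)
have := gp _ _ _ _ _ (ur 0); have := gp _ _ _ _ _ (ur 1).
have := gp _ _ _ _ _ (ur 2); have := gp _ _ _ _ _ (ur 3).
have := gp _ _ _ _ _ (ur 4).
pose t := true; pose f := false.
have := aff _ _ _ _ (um [:: f; t; t; t; t]).
have := aff _ _ _ _ (um [:: t; f; t; t; t]).
have := aff _ _ _ _ (um [:: t; t; f; t; t]).
have := aff _ _ _ _ (um [:: t; t; t; f; t]).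
have := aff _ _ _ _ (um [:: t; t; t; t; f]).
rewrite /crosses /inside.
sort_brackets (um [:: t; t; t; f; f]).
sort_brackets (um [:: t; t; f; t; f]).
sort_brackets (um [:: t; t; f; f; t]).
sort_brackets (um [:: t; f; t; t; f]).
sort_brackets (um [:: t; f; t; f; t]).
sort_brackets (um [:: t; f; f; t; t]).
sort_brackets (um [:: f; t; t; t; f]).
sort_brackets (um [:: f; t; t; f; t]).
sort_brackets (um [:: f; t; f; t; t]).
sort_brackets (um [:: f; f; t; t; t]).
(* With all brackets sorted, both claims are tautologies in ten booleans. *)
move: (o a b c) (o a b d) (o a b e) (o a c d) (o a c e) (o a d e).
move: (o b c d) (o b c e) (o b d e) (o c d e).
by do 10!case.
Qed.

Lemma crosses_sym a b c d : uniq [:: a; b; c; d] ->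
  crosses a b c d = crosses c d a b.
Proof.
move=> us; have um m : uniq (mask m _) := mask_uniq us m.
pose t := true; pose f := false.
rewrite /crosses.
sort_brackets (um [:: t; t; t; f]).
sort_brackets (um [:: t; t; f; t]).
sort_brackets (um [:: t; f; t; t]).
sort_brackets (um [:: f; t; t; t]).
by move: (o a b c) (o a b d) (o a c d) (o b c d); do 4!case.
Qed.

Lemma crossesC a b c d : uniq [:: a; b; c; d] ->
  crosses a b c d = crosses a b d c.
Proof.
move=> us; have um m : uniq (mask m _) := mask_uniq us m.
rewrite /crosses.
have [_ -> _ _ _] := o_swap (um [:: true; false; true; true]).
have [_ -> _ _ _] := o_swap (um [:: false; true; true; true]).
by rewrite addbN addNb negbK [X in _ && X]addbC.
Qed.

(* The parity with which segments leaving [p] meet the closed quadrilateral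
   c0 c1 c2 c3, cut into two triangles. *)
Definition inside4 p c0 c1 c2 c3 : bool :=
  inside p c0 c1 c2 (+) inside p c0 c2 c3.

(** The diagonal [c0 c2] cuts the closed quadrilateral into two triangles. [crosses_parity5] applies
    to each, and the crossings with the diagonal cancel modulo 2. *)
Lemma crosses_path p q c0 c1 c2 c3 : uniq [:: p; q; c0; c1; c2; c3] ->
  crosses p q c0 c1 (+) crosses p q c1 c2 (+) crosses p q c2 c3 =
  crosses p q c0 c3 (+) (inside4 p c0 c1 c2 c3 (+) inside4 q c0 c1 c2 c3).
Proof.
move=> us; have um m : uniq (mask m _) := mask_uniq us m.
pose t := true; pose f := false.
have [e1 _] := crosses_parity5 (um [:: t; t; t; t; t; f]).
have [e2 _] := crosses_parity5 (um [:: t; t; t; f; t; t]).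
rewrite /inside4 addbACA -{}e1 -{}e2.
rewrite (crossesC (um [:: t; t; t; f; t; f])).
rewrite (crossesC (um [:: t; t; t; f; f; t])).
move: (crosses p q c0 c1) (crosses p q c1 c2) (crosses p q c2 c3).
by move: (crosses p q c2 c0) (crosses p q c3 c0); do 5!case.
Qed.

(** [crosses_path] is used for each of the three [p]-segments against the [c]-path, where the
    intermediate [inside4] terms telescope, and then for the chord [c0 c3] against the [p]-path. *)
Lemma crosses_disjoint_paths p0 p1 p2 p3 c0 c1 c2 c3 :
  uniq [:: p0; p1; p2; p3; c0; c1; c2; c3] ->
  (forall s t, s \in [:: (p0, p1); (p1, p2); (p2, p3)] ->
     t \in [:: (c0, c1); (c1, c2); (c2, c3)] -> ~~ crosses s.1 s.2 t.1 t.2) ->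
  crosses p0 p3 c0 c3 =
  inside4 p0 c0 c1 c2 c3 (+) inside4 p3 c0 c1 c2 c3
  (+) (inside4 c0 p0 p1 p2 p3 (+) inside4 c3 p0 p1 p2 p3).
Proof.
move=> us nx; have um m : uniq (mask m _) := mask_uniq us m.
pose t := true; pose f := false.
have nX p q c d : (p, q) \in [:: (p0, p1); (p1, p2); (p2, p3)] ->
    (c, d) \in [:: (c0, c1); (c1, c2); (c2, c3)] -> crosses p q c d = false.
  by move=> h1 h2; exact/negbTE/(nx (p, q) (c, d)).
have := crosses_path (um [:: t; t; f; f; t; t; t; t]).
have := crosses_path (um [:: f; t; t; f; t; t; t; t]).
have := crosses_path (um [:: f; f; t; t; t; t; t; t]).
rewrite (nX p0 p1 c0 c1) ?(nX p0 p1 c1 c2) ?(nX p0 p1 c2 c3);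
  rewrite ?(nX p1 p2 c0 c1) ?(nX p1 p2 c1 c2) ?(nX p1 p2 c2 c3);
  rewrite ?(nX p2 p3 c0 c1) ?(nX p2 p3 c1 c2) ?(nX p2 p3 c2 c3);
  rewrite ?inE ?eqxx ?orbT //=.
have ur : uniq [:: c0; c3; p0; p1; p2; p3].
  rewrite -[X in uniq X]/([:: c0; c3] ++ [:: p0; p1; p2; p3]) uniq_catC.
  exact: (um [:: t; t; t; t; t; f; f; t]).
have := crosses_path ur.
rewrite -(crosses_sym (um [:: t; t; f; f; t; f; f; t])).
rewrite -(crosses_sym (um [:: f; t; t; f; t; f; f; t])).
rewrite -(crosses_sym (um [:: f; f; t; t; t; f; f; t])).
rewrite -(crosses_sym (um [:: t; f; f; t; t; f; f; t])).
do !move: (crosses _ _ _ _); do !move: (inside4 _ _ _ _ _).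
by do 10!case.
Qed.
End Chirotope.

(** * Nonplanarity of K5 for abstract orientations *)

Section K5.
Variable o : let T := ('I_5 * 'I_5)%type in T -> T -> T -> bool.

(* The point (i, i) is the vertex i, and (i, j) with i != j is the point where
   the path from i to j leaves the part of i. *)
Definition edge_path (i j : 'I_5) :=
  [:: ((i, i), (i, j)); ((i, j), (j, i)); ((j, i), (j, j))].

(** Crossing-free paths make the crossing parity of two disjoint straight edges a sum of enclosure
    terms. Over all fifteen pairs these cancel, whereas five points have an odd number of
    crossings. *)
Lemma K5_nonplanar : chirotope o ->
  ~ (forall i j k l, uniq [:: i; j; k; l] ->
       forall s t, s \in edge_path i j -> t \in edge_path k l ->
         ~~ crosses o s.1 s.2 t.1 t.2).
Proof.
move=> oP nx.
(* The parity with which the path from i to j, closed up by the straight segment, encloses the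
   vertex k. *)
pose J (i j k : 'I_5) := inside4 o (k, k) (i, i) (i, j) (j, i) (j, j).
have X i j k l : uniq [:: i; j; k; l] ->
    crosses o (i, i) (j, j) (k, k) (l, l) =
    (J k l i + J k l j + (J i j k + J i j l))%R.
  move=> u; apply: crosses_disjoint_paths => //; last exact: nx.
  move: u; rewrite /= !inE !negb_or !xpair_eqE !andbT -!andbA.
  move=> /and4P[ij ik il /and3P[jk jl kl]].
  rewrite !(eq_sym j i, eq_sym k i, eq_sym l i).
  rewrite !(eq_sym k j, eq_sym l j, eq_sym l k).
  rewrite !(negbTE ij, negbTE ik, negbTE il).
  by rewrite !(negbTE jk, negbTE jl, negbTE kl) ?andbF.
pose v n : 'I_5 := inord n.
have vE m n : m < 5 -> n < 5 -> (v m == v n) = (m == n).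
  by move=> m5 n5; rewrite -val_eqE /= !inordK.
pose vv n := (v n, v n).
have [|_] := @crosses_parity5 _ _ oP (vv 0) (vv 1) (vv 2) (vv 3) (vv 4).
  by rewrite /= !inE !xpair_eqE !vE.
rewrite !X; do ?[by rewrite /= !inE !vE].
set S := (X in is_true X).
(* Each [J a b c] occurs twice, as two edges disjoint from ab end at c. *)
pose H : bool := (
  J (v 0) (v 1) (v 2) + J (v 0) (v 1) (v 3) + J (v 0) (v 1) (v 4) +
  J (v 0) (v 2) (v 1) + J (v 0) (v 2) (v 3) + J (v 0) (v 2) (v 4) +
  J (v 0) (v 3) (v 1) + J (v 0) (v 3) (v 2) + J (v 0) (v 3) (v 4) +
  J (v 0) (v 4) (v 1) + J (v 0) (v 4) (v 2) + J (v 0) (v 4) (v 3) +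
  J (v 1) (v 2) (v 0) + J (v 1) (v 2) (v 3) + J (v 1) (v 2) (v 4) +
  J (v 1) (v 3) (v 0) + J (v 1) (v 3) (v 2) + J (v 1) (v 3) (v 4) +
  J (v 1) (v 4) (v 0) + J (v 1) (v 4) (v 2) + J (v 1) (v 4) (v 3) +
  J (v 2) (v 3) (v 0) + J (v 2) (v 3) (v 1) + J (v 2) (v 3) (v 4) +
  J (v 2) (v 4) (v 0) + J (v 2) (v 4) (v 1) + J (v 2) (v 4) (v 3) +
  J (v 3) (v 4) (v 0) + J (v 3) (v 4) (v 1) + J (v 3) (v 4) (v 2))%R.
(* [addb] is the addition of the ring [bool], so [ring] does the regrouping and [H + H] vanishes
   modulo 2. *)
have -> : S = (H + H)%R by rewrite /S /H -[addb]/(@GRing.add bool); ring.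
by rewrite [(_ + _)%R]addbb.
Qed.
End K5.

Local Open Scope classical_set_scope.
Local Open Scope ring_scope.

(** * Planar drawings *)

Definition segments_meet (R : numDomainType) (T : Type) (x y : T -> R)
    (s t : T * T) :=
  exists a b : R, [/\ 0 <= a <= 1, 0 <= b <= 1,
    x s.1 + a * (x s.2 - x s.1) = x t.1 + b * (x t.2 - x t.1) &
    y s.1 + a * (y s.2 - y s.1) = y t.1 + b * (y t.2 - y t.1)].

Section Orientation.
Variables (R : realFieldType) (T : eqType) (x y : T -> R).

Definition det3 a b c := (x b - x a) * (y c - y a) - (x c - x a) * (y b - y a).
Definition orient a b c := 0 < det3 a b c.
Definition general_position :=
  forall a b c, uniq [:: a; b; c] -> det3 a b c != 0.

Let sgM (u v : R) : u != 0 -> v != 0 ->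
  ((0 < u) == (0 < v)) = (0 < u * v) /\ ((0 < u) != (0 < v)) = (u * v < 0).
Proof.
by rewrite !neq_lt => /orP[] hu /orP[] hv;
  rewrite ?(nmulr_rgt0 _ hu) ?(nmulr_rlt0 _ hu) ?(pmulr_rgt0 _ hu)
    ?(pmulr_rlt0 _ hu) ?(lt_gtF hu) ?(lt_gtF hv) ?hu ?hv.
Qed.

Lemma orient_chirotope : general_position -> chirotope orient.
Proof.
move=> gp; split.
- by move=> a b c; congr (_ < _); rewrite /det3; ring.
- move=> a b c /gp abc0; rewrite /orient.
  have -> : det3 b a c = - det3 a b c by rewrite /det3; ring.
  by rewrite oppr_gt0; case: ltgtP abc0.
- move=> a b c d e us; have um m : uniq (mask m _) := mask_uniq us m.
  have /gp abc := um [:: true; true; true; false; false].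
  have /gp abd := um [:: true; true; false; true; false].
  have /gp abe := um [:: true; true; false; false; true].
  have /gp acd := um [:: true; false; true; true; false].
  have /gp ace := um [:: true; false; true; false; true].
  have /gp ade := um [:: true; false; false; true; true].
  have E : det3 a b c * det3 a d e - det3 a b d * det3 a c e
           + det3 a b e * det3 a c d = 0 by rewrite /det3; ring.
  rewrite /orient; have [-> ->] := sgM abc ade; have [-> ->] := sgM abd ace.
  have [-> ->] := sgM abe acd.
  by apply/andP; split; apply/negP => /and3P[h1 h2 h3]; move: E h1 h2 h3;
     move: (_ * _) (_ * _) (_ * _) => u v w; lra.
- move=> a b c d us; have um m : uniq (mask m _) := mask_uniq us m.
  have /gp abc := um [:: true; true; true; false].
  have /gp abd := um [:: true; true; false; true].
  have /gp acd := um [:: true; false; true; true].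
  have /gp bcd := um [:: false; true; true; true].
  have E : det3 b c d - det3 a c d + det3 a b d - det3 a b c = 0.
    by rewrite /det3; ring.
  rewrite /orient -!leNgt.
  apply/andP; split; apply/negP => /and4P[]; move: E abc abd acd bcd;
  move: (det3 _ _ _) (det3 _ _ _) (det3 _ _ _) (det3 _ _ _) => u v w z.
    by move=> *; lra.
  by rewrite !neq_lt => E /orP[] ? /orP[] ? /orP[] ? /orP[] ? *; lra.
Qed.

Lemma crosses_meet a b c d : general_position -> uniq [:: a; b; c; d] ->
  crosses orient a b c d -> segments_meet x y (a, b) (c, d).
Proof.
move=> gp us; have um m : uniq (mask m _) := mask_uniq us m.
have /gp abc := um [:: true; true; true; false].
have /gp abd := um [:: true; true; false; true].
have /gp acd := um [:: true; false; true; true].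
have /gp bcd := um [:: false; true; true; true].
have E : det3 a c d - det3 b c d = det3 a b d - det3 a b c.
  by rewrite /det3; ring.
pose D := det3 a c d - det3 b c d.
have frac (u v : R) : u != 0 -> v != 0 -> (0 < u) (+) (0 < v) ->
    u - v != 0 /\ 0 <= u / (u - v) <= 1.
  move=> u0 v0; case: (ltgtP 0 u) u0 => // hu _;
    case: (ltgtP 0 v) v0 => // hv _ _.
    have uv : 0 < u - v by lra.
    split; first by rewrite gt_eqF.
    by rewrite ler_pdivlMr // ler_pdivrMr // mul0r mul1r ltW //; lra.
  have uv : u - v < 0 by lra.
  split; first by rewrite lt_eqF.
  by rewrite ler_ndivlMr // ler_ndivrMr // mul0r mul1r ltW //; lra.
rewrite /crosses /orient => /andP[/frac[//|//|D0 sP] /frac[//|//|D0' tP]].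
(* [det3 _ c d] is affine along ab and vanishes at this parameter; the next witness is the zero of
   [det3 a b _] along cd. By [E] the two denominators are opposite. *)
exists (det3 a c d / (det3 a c d - det3 b c d)).
exists (det3 a b c / (det3 a b c - det3 a b d)).
have E' : det3 a b c - det3 a b d = - (det3 a c d - det3 b c d).
  by rewrite E [RHS]opprB.
rewrite {}E' invrN in tP *; rewrite -/D in D0 sP tP *.
have De : D * D^-1 = 1 by rewrite divff.
have combo (u v : R) : u = v * (1 - D * D^-1) -> u = 0.
  by rewrite De subrr mulr0.
by split=> //; apply/subr0_eq;
  [apply: (combo _ (x a - x c)) | apply: (combo _ (y a - y c))];
  move: (D^-1) => e; rewrite /D /det3; ring.
Qed.
End Orientation.

(** * Small perturbations into general position *)

Lemma affine_neq0_near (R : realType) (a b c : R) : a != 0 ->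
  \forall e \near 0^'+, a + e * (b + e * c) != 0.
Proof.
move=> a0.
have : (fun e : R => a + e * (b + e * c)) @ 0^'+ --> a + 0 * (b + 0 * c).
  apply: cvg_at_right_filter; apply: cvgD; first exact: cvg_cst.
  apply: cvgM; first exact: cvg_id.
  by apply: cvgD; [exact: cvg_cst|apply: cvgM; [exact: cvg_id|exact: cvg_cst]].
by rewrite mul0r addr0 => /cvgr_neq0; exact.
Qed.

(** The lowest nonzero coefficient dominates just to the right of 0: if [a] vanishes, a factor [e]
    comes out and the remaining polynomial has a nonzero constant term or is the constant [c] times
    [e]. *)
Lemma quadratic_neq0_near (R : realType) (a b c : R) : c != 0 ->
  \forall e \near 0^'+, a + e * (b + e * c) != 0.
Proof.
move=> c0; have [->|] := eqVneq a 0; last exact: affine_neq0_near.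
have [->|b0] := eqVneq b 0.
  apply: filterS (nbhs_right_gt _) => e e0.
  by rewrite !add0r !mulf_neq0 // gt_eqF.
apply: filterS2 (nbhs_right_gt _) (affine_neq0_near c 0 b0) => e e0.
by rewrite mulr0 addr0 add0r mulf_eq0 (gt_eqF e0).
Qed.

(** At each point of the square one of [u], [v] is nonzero and stays so for nearby points and small
    [e]; compactness of the square makes the bound on [e] uniform. *)
Lemma no_common_zero_near (R : realType) (u u' v v' : R * R -> R) :
  continuous u -> continuous u' -> continuous v -> continuous v' ->
  let K := `[0, 1] `*` `[0, 1] in
  (forall z, K z -> ~ (u z = 0 /\ v z = 0)) ->
  \forall e \near 0^'+, forall z, K z ->
    ~ (u z + e * u' z = 0 /\ v z + e * v' z = 0).
Proof.
move=> cu cu' cv cv' K nz.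
have cK : compact K by apply: compact_setX; exact: segment_compact.
have cov := (iffLR (compact_near_coveringP K)) cK.
apply: cov => z Kz.
have lim (w w' : R * R -> R) : continuous w -> continuous w' -> w z != 0 ->
    \forall z' \near z & e \near 0^'+, w z' + e * w' z' != 0.
  move=> cw cw' wz.
  have : (fun p : (R * R) * R => w p.1 + p.2 * w' p.1)
      @ filter_prod (nbhs z) 0^'+ --> w z + 0 * w' z.
    apply: cvgD; first by apply: cvg_comp; [exact: cvg_fst|exact: cw].
    apply: cvgM.
      apply: cvg_trans cvg_snd _; exact: cvg_within.
    by apply: cvg_comp; [exact: cvg_fst|exact: cw'].
  by rewrite mul0r addr0 => /cvgr_neq0; exact.
have [u0|/lim] := eqVneq (u z) 0; last first.
  by move=> /(_ _ cu cu'); apply: filterS => -[z' e] /= /eqP h [].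
have [v0|/lim] := eqVneq (v z) 0; first by case: (nz _ Kz).
by move=> /(_ _ cv cv'); apply: filterS => -[z' e] /= /eqP h [].
Qed.

Section Perturbation.
Variables (R : realType) (T : finType) (x y : T -> R).

(* Displacing the points along the parabola (r, r^2) makes the leading
   coefficient of each determinant, in [e], a nonzero Vandermonde product. *)
Let r (p : T) : R := (enum_rank p)%:R.
Let xe e p := x p + e * r p.
Let ye e p := y p + e * r p ^+ 2.

Let rB p q : p != q -> r p - r q != 0.
Proof.
rewrite subr_eq0 /r eqr_nat.
by apply: contraNN => /eqP /val_inj /enum_rank_inj ->.
Qed.

Lemma general_position_near :
  \forall e \near 0^'+, general_position (xe e) (ye e).
Proof.
have : \forall e \near (0 : R)^'+, forall p : T * T * T,
    uniq [:: p.1.1; p.1.2; p.2] -> det3 (xe e) (ye e) p.1.1 p.1.2 p.2 != 0.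
  apply: filter_forall => -[[a b] c].
  have [|_] := boolP (uniq [:: a; b; c]); last by apply: nearW.
  rewrite /= !inE negb_or andbT => /andP[/andP[ab ac] bc].
  pose C := (r b - r a) * (r c - r a) * (r c - r b).
  have C0 : C != 0 by rewrite !mulf_neq0 // rB // eq_sym.
  pose B := (x b - x a) * (r c ^+ 2 - r a ^+ 2) + (r b - r a) * (y c - y a)
    - (x c - x a) * (r b ^+ 2 - r a ^+ 2) - (r c - r a) * (y b - y a).
  apply: filterS (quadratic_neq0_near (det3 x y a b c) B C0) => e h _.
  apply: contraNN h => /eqP <-; apply/eqP; rewrite /det3 /B /C /xe /ye; ring.
by apply: filterS => e h a b c; exact: (h (a, b, c)).
Qed.

(** The gap between two parametrised points is linear in the coordinates, so the displacement adds
    [e] times its own gap. [no_common_zero_near] handles one pair of segments, and there are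
    finitely many pairs. *)
Lemma segments_disjoint_near : \forall e \near 0^'+, forall s t,
  ~ segments_meet x y s t -> ~ segments_meet (xe e) (ye e) s t.
Proof.
have : \forall e \near (0 : R)^'+, forall q : (T * T) * (T * T),
    ~ segments_meet x y q.1 q.2 -> ~ segments_meet (xe e) (ye e) q.1 q.2.
  apply: filter_forall => -[[p q] [c d]] /=.
  have [m|nm] := pselect (segments_meet x y (p, q) (c, d)).
    by apply: nearW => e /(_ m).
  pose f (w : T -> R) (z : R * R) :=
    w p + z.1 * (w q - w p) - (w c + z.2 * (w d - w c)).
  have fc w : continuous (f w).
    have cM (g : R * R -> R) u v : continuous g ->
        continuous (fun z => u + g z * v).
      move=> cg z; apply: cvgD; first exact: cvg_cst.
      by apply: cvgM; [exact: cg|exact: cvg_cst].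
    move=> z; apply: cvgB; apply: cM => z'; [exact: cvg_fst|exact: cvg_snd].
  have nz z : (`[0, 1] `*` `[0, 1]) z -> ~ (f x z = 0 /\ f y z = 0).
    case: z => a b [/= a01 b01] [/subr0_eq xE /subr0_eq yE].
    apply: nm; exists a, b; split=> /=; rewrite -?in_itv /=;
      [exact: a01|exact: b01|exact: xE|exact: yE].
  have := no_common_zero_near (fc x) (fc r) (fc y) (fc (fun p => r p ^+ 2)) nz.
  apply: filterS => e h _ [a [b [a01 b01 xE yE]]]; apply: (h (a, b)).
    by split; rewrite /= in_itv.
  move: xE yE; rewrite /f /xe /ye /= => xE yE.
  by split; [move/eqP: xE|move/eqP: yE]; rewrite -subr_eq0 => /eqP <-; ring.
by apply: filterS => e h s t; exact: (h (s, t)).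
Qed.
End Perturbation.

Lemma K5_not_planar (R : realType) (x y : 'I_5 * 'I_5 -> R) :
  ~ (forall i j k l, uniq [:: i; j; k; l] ->
       forall s t, s \in edge_path i j -> t \in edge_path k l ->
         ~ segments_meet x y s t).
Proof.
move=> nm.
have [e [gp nme]] := filter_ex
  (filterI (general_position_near x y) (segments_disjoint_near x y)).
apply: (K5_nonplanar (orient_chirotope gp)) => i j k l u s t si tk.
apply/negP => /(crosses_meet gp) m; apply: (nme s t); first exact: (nm i j k l).
(* The four ends are distinct: first indices lie in {i, j} on one path and in {k, l} on the
   other. *)
apply: m; move: u si tk; rewrite /= !inE !negb_or -!andbA.
move=> /and4P[ij ik il /and4P[jk jl kl _]].
by move=> /or3P[]/eqP-> /or3P[]/eqP->; rewrite /= !xpair_eqE ?eqxx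
  !(negbTE ij, negbTE ik, negbTE il, negbTE jk, negbTE jl, negbTE kl,
    eq_sym j i, eq_sym k i, eq_sym l i, eq_sym k j, eq_sym l j, eq_sym l k)
  ?andbF.
Qed.

(** * Convex sets without interior *)

Lemma cvg_sumr (R : realType) (T I : Type) (F : set_system T) (FF : Filter F)
    (s : seq I) (f : I -> T -> R) (l : I -> R) :
  (forall i, f i x @[x --> F] --> l i) ->
  \sum_(i <- s) f i x @[x --> F] --> \sum_(i <- s) l i.
Proof. by move=> fl; apply: cvg_big => //; exact: add_continuous. Qed.

Lemma convex_set_conv (R : numDomainType) (V : lmodType R) (D : set V) a b
    (l : R) :
  convex_set D -> D a -> D b -> 0 <= l <= 1 -> D (l *: a + (1 - l) *: b).
Proof.
move=> cD Da Db /andP[l0 l1].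
by have := cD a b (Itv01 l0 l1); rewrite !inE; exact.
Qed.

(** One term is split off and the others are rescaled by the inverse of [1 - l i], which the strict
    bound keeps positive; the missing weight sits at [o]. *)
Lemma convex_set_subsimplex (R : realFieldType) (V : lmodType R) (D : set V)
    (I : Type) (s : seq I) (l : I -> R) (o : V) (v : I -> V) :
  convex_set D -> D o -> (forall i, D (o + v i)) -> (forall i, 0 <= l i) ->
  \sum_(i <- s) l i < 1 -> D (o + \sum_(i <- s) l i *: v i).
Proof.
move=> cD Do Dv; elim: s l => [|i s IH] l l0; first by rewrite !big_nil addr0.
rewrite !big_cons => ls.
have rest0 : 0 <= \sum_(j <- s) l j by apply: sumr_ge0.
have li1 : 0 < 1 - l i by lra.
have -> : o + (l i *: v i + \sum_(j <- s) l j *: v j) =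
    l i *: (o + v i) +
    (1 - l i) *: (o + \sum_(j <- s) ((1 - l i)^-1 * l j) *: v j).
  under [in RHS]eq_bigr do rewrite -scalerA.
  rewrite -scaler_sumr !scalerDr scalerA divff ?gt_eqF // scale1r addrACA.
  by rewrite -scalerDl [l i + _]addrC subrK scale1r.
apply: convex_set_conv => //; last by rewrite l0; lra.
apply: IH => [j|]; first by rewrite mulr_ge0 ?invr_ge0 // ltW.
by rewrite -mulr_sumr mulrC ltr_pdivrMr // mul1r; lra.
Qed.

(** The coordinates [lam] with respect to [o] and the rows of [N] are continuous, so the conditions
    defining the open simplex persist near a central point. *)
Lemma convex_simplex_interior (R : realType) n (D : set 'rV[R]_n.+1)
    (o : 'rV[R]_n.+1) (N : 'M[R]_n.+1) :
  convex_set D -> N \in unitmx -> D o -> (forall i, D (o + row i N)) ->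
  interior D !=set0.
Proof.
move=> cD uN Do DN.
pose lam (y : 'rV[R]_n.+1) i := ((y - o) *m invmx N) 0 i.
(* The n+1 equal coordinates of [c] then add up to (n+1)/(n+2), which is below 1. *)
pose a : R := n.+2%:R^-1.
have a0 : 0 < a by rewrite invr_gt0.
pose c : 'rV[R]_n.+1 := o + const_mx a *m N.
have lamc i : lam c i = a by rewrite /lam /c addrC addKr mulmxK // mxE.
have lamE y i : lam y i = \sum_j (y 0 j - o 0 j) * invmx N j i.
  by rewrite /lam mxE; apply: eq_bigr => j _; rewrite !mxE.
have clam i : lam y i @[y --> c] --> lam c i.
  under eq_fun do rewrite lamE; rewrite lamE.
  apply: (cvg_sumr (nbhs_filter c)) => j.
  apply: cvgM; last exact: cvg_cst.
  apply: cvgB; last exact: cvg_cst.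
  exact: coord_continuous.
exists c; rewrite /interior /=.
have near_pos : \forall y \near c, forall i, 0 < lam y i.
  apply: (@filter_forall _ _ _ _ (nbhs_filter c)) => i.
  have := clam i; rewrite lamc.
  by move=> /cvgr_gt; apply.
have near_lt1 : \forall y \near c, \sum_i lam y i < 1.
  have : (fun y => \sum_i lam y i) @ c --> \sum_i lam c i.
    exact: (cvg_sumr (nbhs_filter c)).
  under eq_bigr do rewrite lamc; move=> /cvgr_lt; apply.
  rewrite sumr_const card_ord -mulr_natl ltr_pdivrMr // mul1r ltr_nat //.
apply: (@filterS2 _ _ (nbhs_filter c) _ _ _ _ near_pos near_lt1) => y y0 y1.
have -> : y = o + \sum_i lam y i *: row i N.
  rewrite -[LHS](subrK o) addrC; congr (_ + _).
  by rewrite -[LHS](mulmxKV uN) [LHS]mulmx_sum_row.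
by apply: convex_set_subsimplex => // i; exact: ltW.
Qed.

(** Were the differences to a base point of full rank, n+1 independent ones would span a simplex
    inside [D]. So the rank is at most n, and the rank factorisation passes through dimension n. *)
Lemma convex_no_interior_flat (R : realType) n (D : set 'rV[R]_n.+1)
    (I : finType) (q : I -> 'rV[R]_n.+1) :
  convex_set D -> interior D = set0 -> (forall i, D (q i)) ->
  exists (o : 'rV[R]_n.+1) (B : 'M[R]_(n, n.+1)) (w : I -> 'rV[R]_n),
    forall i, q i = o + w i *m B.
Proof.
move=> cD iD Dq.
have [i0 _|noI] := pickP (@predT I); last first.
  by exists 0, 0, (fun=> 0) => i; have := noI i.
pose M := \matrix_(k < #|I|) (q (enum_val k) - q i0).
have rM (k : 'I_#|I|) : row k M = q (enum_val k) - q i0 by rewrite rowK.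
have Mn : (\rank M <= n)%N.
  rewrite leqNgt; apply/negP => Mfull.
  have fM : row_full M by rewrite /row_full eqn_leq rank_leq_col.
  have [|x] := convex_simplex_interior cD (fullrowsub_unit fM) (Dq i0).
    by move=> i; rewrite row_rowsub rM addrC subrK.
  by rewrite iD.
exists (q i0), (pid_mx (\rank M) *m row_ebase M).
exists (fun i => row (enum_rank i) (col_ebase M *m pid_mx (\rank M))).
move=> i; rewrite -row_mul -!mulmxA [pid_mx _ *m (_ *m _)]mulmxA mul_pid_mx.
by rewrite minnn (minn_idPr Mn) mulmxA mulmx_ebase rM enum_rankK addrC subrK.
Qed.

Definition edge_end (i : 'I_5) (e : 'I_5 * 'I_5) : bool :=
  (i == e.1) || (i == e.2).

Lemma no_convex_contact (R : realType) (b c : set 'rV[R]_3)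
    (A : 'I_5 -> set 'rV[R]_3) (C : 'I_5 * 'I_5 -> set 'rV[R]_3) :
  convex_set b -> convex_set c -> interior b `&` interior c = set0 ->
  (forall i, convex_set (A i)) -> (forall e, convex_set (C e)) ->
  (forall i, A i `<=` b) -> (forall e, C e `<=` c) ->
  (forall i j, i != j -> A i `&` A j = set0) ->
  (forall e f, e != f -> C e `&` C f = set0) ->
  (forall i e, edge_end i e -> A i `&` C e !=set0) ->
  (forall i e, ~~ edge_end i e -> A i `&` C e = set0) -> False.
Proof.
move=> cb cc bc0 cA cC Ab Cc AA CC AC AC0.
(* Sorting the ends places [q (i, j)] and [q (j, i)] in the same edge part, which then carries the
   middle segment of the path. *)
pose e (i j : 'I_5) := if (i <= j)%N then (i, j) else (j, i).
have eC i j : e i j = e j i.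
  rewrite /e; case: (ltngtP i j) => // ij.
  by rewrite (val_inj ij).
have eP k i j : edge_end k (e i j) = (k == i) || (k == j).
  by rewrite /e /edge_end; case: ifP => //=; rewrite orbC.
have /choice[q qP] : forall p : 'I_5 * 'I_5, exists z,
    (A p.1 `&` C (e p.1 p.2)) z.
  by move=> p; apply: AC; rewrite eP eqxx.
have ibc : interior (b `&` c) = set0 by rewrite interiorI.
have cD : convex_set (b `&` c).
  move=> u v l; rewrite !inE => -[bu cu] [bv cv].
  by split; apply/set_mem; [apply: cb|apply: cc]; rewrite inE.
have Dq p : (b `&` c) (q p).
  by have [/Ab ? /Cc ?] := qP p; split.
have [orig [B [w wE]]] := convex_no_interior_flat cD ibc Dq.
apply: (@K5_not_planar R (fun p => w p 0 0) (fun p => w p 0 1)).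
have carrier i j s : s \in edge_path i j -> exists Z,
    [/\ convex_set Z, Z (q s.1), Z (q s.2) &
        [\/ Z = A i, Z = A j | Z = C (e i j)]].
  have Aq k l : A k (q (k, l)) by have [] := qP (k, l).
  have Cq k l : C (e k l) (q (k, l)) by have [] := qP (k, l).
  rewrite !inE => /or3P[]/eqP->.
  - by exists (A i); split=> //=; apply: Or31.
  - by exists (C (e i j)); split=> //=; [rewrite eC|apply: Or33].
  - by exists (A j); split=> //=; apply: Or32.
move=> i j k l u s t /carrier[Z [cZ Zs Zs' ZE]] /carrier[Y [cY Yt Yt' YE]].
move=> [x [y [x01 y01 E0 E1]]].
have wst : w s.1 + x *: (w s.2 - w s.1) = w t.1 + y *: (w t.2 - w t.1).
  apply/rowP => m; rewrite !mxE.
  case: (boolP (m == 0)) => [/eqP->//|m0].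
  have -> // : m = 1.
  by apply/val_inj; case: m m0 => -[|[|//]].
(* The affine map sends a meeting point of the planar segments to a common point of the spatial
   ones. *)
have onq p p' a :
    q p + a *: (q p' - q p) = orig + (w p + a *: (w p' - w p)) *m B.
  by rewrite !wE mulmxDl -scalemxAl mulmxBl opprD addrACA subrr add0r addrA.
have onZ (W : set 'rV[R]_3) p p' a : convex_set W -> W (q p) -> W (q p') ->
    0 <= a <= 1 -> W (q p + a *: (q p' - q p)).
  move=> cW Wp Wp' a01; have := convex_set_conv cW Wp' Wp a01.
  by rewrite scalerBl scale1r scalerBr addrCA.
have ZY : (Z `&` Y) (q s.1 + x *: (q s.2 - q s.1)).
  split; first exact: onZ.
  by rewrite onq wst -onq; exact: onZ.
suff : Z `&` Y = set0 by move=> ZY0; rewrite ZY0 in ZY.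
move: u; rewrite /= !inE !negb_or -!andbA.
move=> /and4P[ij ik il /and4P[jk jl kl _]].
have ACe m n p : m != n -> m != p -> A m `&` C (e n p) = set0.
  by move=> mn mp; apply: AC0; rewrite eP negb_or mn.
have ijkl : e i j != e k l.
  apply/eqP => E; have := eP i i j.
  by rewrite E eP eqxx (negbTE ik) (negbTE il).
by case: ZE => ->; case: YE => ->; rewrite ?AA ?CC ?ACe //;
  rewrite setIC ACe // eq_sym.
Qed.

(** * Regions spanned by open sets *)

Section RegularOpen.
Variable T : topologicalType.
Implicit Types U V : set T.

Lemma open_sub_interior_closure U : open U -> U `<=` interior (closure U).
Proof.
move=> oU; rewrite -[X in X `<=` _]((interior_id U).1 oU).
exact/interiorS/subset_closure.
Qed.

Lemma closure_interior_closure U : open U ->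
  closure U = closure (interior (closure U)).
Proof.
move=> oU; apply/seteqP; split; first exact/closureS/open_sub_interior_closure.
apply: subset_trans (closureS (@interior_subset _ (closure U))) _.
by rewrite -((closure_id (closure U)).1 (@closed_closure _ U)).
Qed.

Lemma disjoint_open_closure U V : open V -> U `&` V = set0 ->
  closure U `&` V = set0.
Proof.
move=> oV UV0; rewrite -subset0 => x [xU xV].
have [y UVy] := xU V (open_nbhs_nbhs (conj oV xV)).
by move: UVy; rewrite UV0.
Qed.

Lemma disjoint_interior_closure U V : open U -> open V -> U `&` V = set0 ->
  interior (closure U) `&` closure V = set0.
Proof.
move=> oU oV UV0; rewrite setIC; apply: disjoint_open_closure.
  exact: open_interior.
rewrite -subset0 => x [Vx Ux].
by rewrite -(disjoint_open_closure oV UV0); split=> //; exact: interior_subset.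
Qed.
End RegularOpen.

Section OpenRegions.
Variables (R : realType) (n : nat).
Implicit Types U V : set 'rV[R]_n.

Definition open_region U (oU : open U) (neU : U !=set0) : region R n :=
  @Region R n (closure U) (subset_nonempty (@subset_closure _ U) neU)
    (closure_interior_closure oU).

Lemma open_region_EC U V oU oV neU neV : U `&` V = set0 ->
  closure U `&` closure V !=set0 ->
  rcc8_holds EC (@open_region U oU neU) (@open_region V oV neV).
Proof.
move=> UV0 UV; split=> //; rewrite -subset0 => x [Ux /interior_subset Vx].
by rewrite -(disjoint_interior_closure oU oV UV0).
Qed.

(* The sets [V] and [W] witness that [closure U] misses part of [closure U'],
   resp. reaches its boundary. *)
Lemma open_region_TPP U U' V W oU oU' neU neU' : open V -> open W ->
  U `<=` U' -> V `<=` U' -> V !=set0 -> U `&` V = set0 -> U' `&` W = set0 ->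
  closure U `&` closure W !=set0 ->
  rcc8_holds TPP (@open_region U oU neU) (@open_region U' oU' neU').
Proof.
move=> oV oW UU' VU' [v Vv] UV UW [w [Uw Ww]]; split.
  split=> [|clU]; first exact: closureS.
  have : (closure U `&` V) v.
    by split=> //; apply: clU; apply: subset_closure; exact: VU'.
  by rewrite disjoint_open_closure.
move=> [sub _]; have : (interior (closure U') `&` closure W) w.
  by split=> //; exact: sub.
by rewrite disjoint_interior_closure.
Qed.
End OpenRegions.

(** * Finite unions of unit intervals on the line *)

Section LineCells.
Variables (R : realType) (P : finType).
Implicit Types (S : {pred P}) (s : bool) (z : 'rV[R]_1).

(* The index [p] owns the two adjacent unit cells ]3k, 3k + 1[ and
   ]3k + 1, 3k + 2[ with k the rank of [p]; [s] chooses between them. *)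
Definition cell s (p : P) : nat := (3 * enum_rank p + s)%N.

Definition cells s S : set 'rV[R]_1 :=
  [set z | exists2 p, p \in S & (cell s p)%:R < z 0 0 < (cell s p).+1%:R].

Lemma open_cells s S : open (cells s S).
Proof.
have -> : cells s S = \bigcup_(p in [set p | p \in S])
    ((fun z => z 0 0) @^-1` `](cell s p)%:R, (cell s p).+1%:R[).
  apply/seteqP; split=> z.
    by move=> [p Sp zp]; exists p; rewrite //= in_itv.
  by move=> [p Sp /=]; rewrite in_itv => zp; exists p.
apply: bigcup_open => p _.
apply: open_comp => [z _|]; last exact: interval_open.
exact: coord_continuous.
Qed.

Lemma cells_nonempty s S p : p \in S -> cells s S !=set0.
Proof.
move=> Sp; exists (const_mx ((cell s p)%:R + 2^-1)); exists p => //.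
by rewrite mxE -[(cell s p).+1%:R]natr1; apply/andP; split; lra.
Qed.

Lemma cellsS s S S' : {subset S <= S'} -> cells s S `<=` cells s S'.
Proof. by move=> SS' z [p /SS' Sp zp]; exists p. Qed.

Lemma cell_inj s s' p p' : cell s p = cell s' p' -> (s, p) = (s', p').
Proof.
move=> E; suff [-> /val_inj/enum_rank_inj ->] :
  s = s' /\ enum_rank p = enum_rank p' :> nat by [].
by move: E; rewrite /cell; case: s; case: s' => /=; lia.
Qed.

Lemma cells_disjoint s s' S S' :
  (forall p, p \in S -> p \in S' -> s != s') ->
  cells s S `&` cells s' S' = set0.
Proof.
move=> dis; rewrite -subset0 => z [[p Sp /andP[z1 z2]] [p' Sp' /andP[z1' z2']]].
have /cell_inj[ss' pp'] : cell s p = cell s' p'.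
  by apply/eqP; rewrite eqn_leq; apply/andP; split; rewrite -ltnS -(ltr_nat R);
    [exact: lt_trans z1 z2'|exact: lt_trans z1' z2].
by move: (dis p Sp); rewrite ss' eqxx pp' => /(_ Sp').
Qed.

Lemma nbhs_rV1 z (B : set 'rV[R]_1) : nbhs z B ->
  exists2 e : R, 0 < e & forall y : 'rV[R]_1, `|z 0 0 - y 0 0| < e -> B y.
Proof.
move=> /nbhs_ballP[e /= e0 sB]; exists e => // y zy; apply: sB.
by split=> // i j; rewrite !ord1.
Qed.

Lemma cells_touch S S' p : p \in S -> p \in S' ->
  closure (cells false S) `&` closure (cells true S') !=set0.
Proof.
move=> Sp Sp'; pose t : R := (cell true p)%:R; exists (const_mx t).
have tE : t = (cell false p)%:R + 1 by rewrite /t /cell addn0 addn1 natr1.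
split=> B /nbhs_rV1[e e0 sB].
(* A step of length [m] stays both in the given neighbourhood and in the unit cell. *)
- pose m := Num.min (e / 2) 2^-1.
  have [me m2] : m <= e / 2 /\ m <= 2^-1 by split; rewrite ge_min lexx ?orbT.
  have m0 : 0 < m by rewrite lt_min; apply/andP; split; lra.
  exists (const_mx (t - m)); split; last first.
    by apply: sB; rewrite !mxE ltr_norml; apply/andP; split; lra.
  by exists p => //; rewrite mxE -natr1; apply/andP; split; lra.
- pose m := Num.min (e / 2) 2^-1.
  have [me m2] : m <= e / 2 /\ m <= 2^-1 by split; rewrite ge_min lexx ?orbT.
  have m0 : 0 < m by rewrite lt_min; apply/andP; split; lra.
  exists (const_mx (t + m)); split; last first.
    by apply: sB; rewrite !mxE ltr_norml; apply/andP; split; lra.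
  by exists p => //; rewrite mxE -natr1 -/t; apply/andP; split; lra.
Qed.

(** The third unit of each block stays empty, so cells of distinct indices are at least 1 apart and
    no point is within 1/2 of both. *)
Lemma cells_separated s s' S S' : (forall p, p \in S -> p \in S' -> False) ->
  closure (cells s S) `&` closure (cells s' S') = set0.
Proof.
move=> dis; rewrite -subset0 => x [xS xS'].
have half0 : 0 < 2^-1 :> R by [].
have [y [[p Sp /andP[y1 y2]] xy]] := xS _ (nbhsx_ballx x _ half0).
have [y' [[p' Sp' /andP[y1' y2']] xy']] := xS' _ (nbhsx_ballx x _ half0).
have {}xy : `|x 0 0 - y 0 0| < 2^-1 by have [_] := xy; exact.
have {}xy' : `|x 0 0 - y' 0 0| < 2^-1 by have [_] := xy'; exact.
have pp' : enum_rank p != enum_rank p' :> nat.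
  apply/eqP => /val_inj/enum_rank_inj E; apply: (dis p) => //; by rewrite E.
have : ((cell s p).+2 <= cell s' p')%N || ((cell s' p').+2 <= cell s p)%N.
  move: pp'; rewrite /cell.
  by case: s {y1 y2 xS}; case: s' {y1' y2' xS'} => /=; lia.
move: xy xy' y1 y2; rewrite !ltr_norml => /andP[? ?] /andP[? ?].
move: y1' y2'; rewrite -![(cell _ _).+1%:R]natr1 => ? ? ? ?.
by case/orP; rewrite -(ler_nat R) -natr1 -[(cell _ _).+1%:R]natr1 => ?; lra.
Qed.
End LineCells.

(** * The network *)

(* [body false] contains the vertex parts and [body true] the edge parts.  Edges
   are all ordered pairs; the contact of the part of i with that of the loop
   (i, i) is used as the vertex i of the drawing. *)
Definition K5_var : finType := (bool + ('I_5 + 'I_5 * 'I_5))%type.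

Definition body (s : bool) : K5_var := inl s.
Definition vertex (i : 'I_5) : K5_var := inr (inl i).
Definition edge (e : 'I_5 * 'I_5) : K5_var := inr (inr e).

Inductive K5_link : K5_var -> K5_var -> rcc8 -> Prop :=
| LinkBodies : K5_link (body false) (body true) EC
| LinkVertexIn i : K5_link (vertex i) (body false) TPP
| LinkVertexOut i : K5_link (vertex i) (body true) EC
| LinkEdgeIn e : K5_link (edge e) (body true) TPP
| LinkEdgeOut e : K5_link (body false) (edge e) EC
| LinkVertices i j : i != j -> K5_link (vertex i) (vertex j) DC
| LinkEdges e f : e != f -> K5_link (edge e) (edge f) DC
| LinkIncident i e : edge_end i e -> K5_link (vertex i) (edge e) EC
| LinkNonincident i e : ~~ edge_end i e -> K5_link (vertex i) (edge e) DC.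

Definition K5_network : rcc8_network K5_var :=
  [set k | exists2 r, K5_link (cfst k) (csnd k) r & crel k = [set r]].

Lemma K5_network_solution (R : realType) n (S : K5_var -> region R n) :
  solution K5_network S <->
  forall u v r, K5_link u v r -> rcc8_holds r (S u) (S v).
Proof.
split=> [sol u v r uvr|sol k [r kr ->]]; last by exists r => //; exact: sol.
have r0 : [set r] !=set0 by exists r.
by have [|_ ->] := sol (Constraint u v r0); first by exists r.
Qed.

Lemma K5_network_atomic : atomic K5_network.
Proof.
have links u v r : K5_link u v r -> exists2 c, K5_network c &
    (cfst c = u /\ csnd c = v) /\ exists r, crel c = [set r].
  move=> uvr; have r0 : [set r] !=set0 by exists r.
  by exists (Constraint u v r0); [exists r|split=> //; exists r].
suff total u v : u <> v -> exists r, K5_link u v r \/ K5_link v u r.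
  move=> u v /total[r [] /links[c Nc [? ?]]]; exists c => //; split=> //.
    by left.
  by right.
case: u => [[]|[i|e]]; case: v => [[]|[j|f]] uv //.
- by exists EC; right; constructor.
- by exists EC; right; constructor.
- by exists TPP; right; constructor.
- by exists EC; left; constructor.
- by exists TPP; right; constructor.
- by exists EC; left; constructor.
- by exists EC; left; constructor.
- by exists TPP; left; constructor.
- by exists DC; left; constructor; apply/eqP => ij; rewrite ij in uv.
- by case: (boolP (edge_end i f)) => h; [exists EC|exists DC]; left;
    constructor.
- by exists TPP; left; constructor.
- by exists EC; right; constructor.
- by case: (boolP (edge_end j e)) => h; [exists EC|exists DC]; right;
    constructor.
- by exists DC; left; constructor; apply/eqP => ef; rewrite ef in uv.
Qed.

Lemma K5_network_over : network_over [set EC; DC; TPP; TPPi] K5_network.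
Proof.
move=> k [r kr ->] _ ->; by case: kr => *; rewrite /setU /=; tauto.
Qed.

(** Every pair of a vertex and an edge owns a possible contact point. A vertex part takes the left
    cells of all its pairs, an edge part the right cells only at its own ends, so they touch exactly
    when incident. *)
Lemma K5_network_consistent (R : realType) : consistent R K5_network.
Proof.
pose P : finType := ('I_5 * ('I_5 * 'I_5))%type.
pose side (v : K5_var) :=
  match v with inl s => s | inr (inl _) => false | inr (inr _) => true end.
pose sel (v : K5_var) : {pred P} := fun p =>
  match v with
  | inl _ => true
  | inr (inl i) => p.1 == i
  | inr (inr e) => (p.2 == e) && edge_end p.1 e
  end.
have selV i p : (p \in sel (inr (inl i))) = (p.1 == i) by [].
have selE e p : (p \in sel (inr (inr e))) = (p.2 == e) && edge_end p.1 e by [].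
have ne v : @cells R P (side v) (sel v) !=set0.
  pose w : P := match v with
    | inl _ => (ord0, (ord0, ord0))
    | inr (inl i) => (i, (i, i))
    | inr (inr e) => (e.1, e)
    end.
  apply: (@cells_nonempty _ _ _ _ w).
  rewrite {}/w; case: v => [s|[i|e]] //; rewrite ?selV ?selE ?eqxx //=.
  by rewrite /edge_end eqxx.
exists 1%N; split=> //.
exists (fun v => open_region (@open_cells R P (side v) (sel v)) (ne v)).
apply/K5_network_solution.
have ec u v p : p \in sel u -> p \in sel v -> side u = false -> side v = true ->
    rcc8_holds EC (open_region (@open_cells R P (side u) (sel u)) (ne u))
      (open_region (@open_cells R P (side v) (sel v)) (ne v)).
  move=> pu pv su sv; apply: open_region_EC; last first.
    by rewrite su sv; exact: cells_touch pu pv.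
  by apply: cells_disjoint => *; rewrite su sv.
(* The cell of [p'] makes the inclusion proper; at [p] the part reaches the cells of the opposite
   side, hence the boundary of its body. *)
have tpp u s p p' : p \in sel u -> p' \notin sel u -> side u = s ->
    rcc8_holds TPP (open_region (@open_cells R P (side u) (sel u)) (ne u))
      (open_region (@open_cells R P s predT) (ne (body s))).
  move=> pu pu' <-.
  apply: (@open_region_TPP _ _ _ _ (@cells R P (side u) (pred1 p'))
    (@cells R P (~~ side u) predT)).
  - exact: open_cells.
  - exact: open_cells.
  - exact: cellsS.
  - exact: cellsS.
  - by apply: (@cells_nonempty _ _ _ _ p'); rewrite inE.
  - apply: cells_disjoint => q uq; rewrite inE => /eqP qp'.
    by rewrite -qp' uq in pu'.
  - by apply: cells_disjoint => *; case: (side u).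
  - case: (side u); last exact: cells_touch pu _.
    by rewrite setIC; exact: cells_touch _ pu.
move=> u v r; case=> [|i|i|e|e|i j ij|e f ef|i e ie|i e ie].
- exact: (ec _ _ (ord0, (ord0, ord0))).
- apply: (tpp (vertex i) false (i, (i, i)) (lift i ord0, (i, i))) => //.
    by rewrite ?selV ?selE /=.
  by rewrite ?selV ?selE /= eq_sym neq_lift.
- by apply: (ec _ _ (i, (i, i))) => //; rewrite ?selV ?selE /=.
(* The second index is an edge differing from [e] in its first end, so its cell is left out of the
   part of [e]. *)
- apply: (tpp (edge e) true (e.1, e) (e.1, (lift e.1 ord0, ord0))) => //.
    by rewrite ?selV ?selE /= eqxx /edge_end eqxx.
  rewrite ?selV ?selE /= negb_and; apply/orP; left.
  apply/eqP => /(congr1 fst) /= E.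
  by have := neq_lift e.1 ord0; rewrite E eqxx.
- by apply: (ec _ _ (e.1, e)) => //; rewrite ?selV ?selE /= eqxx /edge_end eqxx.
- apply: cells_separated => p; rewrite ?selV /= => /eqP-> /eqP E.
  by rewrite E eqxx in ij.
- apply: cells_separated => p; rewrite ?selE /=.
  move=> /andP[/eqP-> _] /andP[/eqP E _].
  by rewrite E eqxx in ef.
- by apply: (ec _ _ (i, e)); rewrite // ?selV ?selE /= eqxx.
- apply: cells_separated => p; rewrite ?selV ?selE /= => /eqP-> /andP[_ h].
  by rewrite h in ie.
Qed.

Lemma K5_network_no_convex (R : realType) (S : K5_var -> region R 3) :
  ~ convex_solution K5_network S.
Proof.
move=> [/K5_network_solution sol cS].
apply: (no_convex_contact (cS (body false)) (cS (body true)) _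
  (fun i => cS (vertex i)) (fun e => cS (edge e))).
- by have [] := sol _ _ _ LinkBodies.
- by move=> i; have [[]] := sol _ _ _ (LinkVertexIn i).
- by move=> e; have [[]] := sol _ _ _ (LinkEdgeIn e).
- by move=> i j ij; exact: sol _ _ _ (LinkVertices ij).
- by move=> e f ef; exact: sol _ _ _ (LinkEdges ef).
- by move=> i e ie; have [] := sol _ _ _ (LinkIncident ie).
- by move=> i e ie; exact: sol _ _ _ (LinkNonincident ie).
Qed.

Theorem proposition15 (R : realType) :
  exists (V : finType) (N : rcc8_network V),
    [/\ consistent R N,
        atomic N,
        network_over [set EC; DC; TPP; TPPi] N &
        ~ exists S : V -> region R 3, convex_solution N S].
Proof.
exists K5_var, K5_network; split.
- exact: K5_network_consistent.
- exact: K5_network_atomic.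
- exact: K5_network_over.
- by move=> [S]; exact: K5_network_no_convex.
Qed.
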